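(* Let $\{P_\theta:\theta\in\Theta\}$ be a model indexed by a countable set $\Theta$. Assume $X^n=(X_1,\dots,X_n)$ has iid components with distribution $P$, and let $\hat\theta$ be the penalized MLE over $\Theta$ (iid modeling) with penalty $\mathcal{L}$. Then for any $\alpha\in[0,1)$, $$\mathbb{E}\,D_B(P,P_{\hat\theta})\le\frac{1}{1-\alpha}\left[\mathcal{R}^{(n)}_{\Theta,\mathcal{L}}(P)+\frac{2\log\sum_{\theta\in\Theta}e^{-\frac12\mathcal{L}(\theta)}A(P,P_\theta)^{\alpha n}}{n}\right].$$
   Context: Lower-case letters denote densities: $p$ and $p_\theta$ are the densities of $P$ and $P_\theta$ with respect to a common dominating measure (Lebesgue or counting measure). The Hellinger affinity is $A(P,Q)=\int\sqrt{p(x)q(x)}\,dx$, the Bhattacharyya divergence is $D_B(P,Q)=2\log\frac{1}{A(P,Q)}$, and $D(P\|Q)$ is relative entropy; all are for a single observation. The penalty is a function $\mathcal{L}:\Theta\to\mathbb{R}$. The penalized MLE $\hat\theta=\hat\theta(X^n)$ is a parameter maximizing $\sum_{i=1}^n\log p_\theta(X_i)-\mathcal{L}(\theta)$ over $\theta\in\Theta$; a maximizer is assumed to exist for every possible data value (ties broken arbitrarily). $\mathcal{R}^{(n)}_{\Theta,\mathcal{L}}(P)=\inf_{\theta\in\Theta}\{D(P\|P_\theta)+\mathcal{L}(\theta)/n\}$. Expectations are over $X^n\sim P^n$. *)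

(* Defs.v *)
From HB Require Import structures.
From mathcomp Require Import all_boot all_order all_algebra.
From mathcomp Require Import all_classical all_reals all_analysis.

Set Implicit Arguments.
Unset Strict Implicit.
Unset Printing Implicit Defensive.

Import Order.TTheory GRing.Theory Num.Theory.
Import numFieldNormedType.Exports.

Local Open Scope classical_set_scope.
Local Open Scope ring_scope.
Local Open Scope ereal_scope.

(* The dominating measure mu is arbitrary; Lebesgue and counting measure are
   the cases of interest. *)
Definition is_density {d : measure_display} {T : measurableType d}
    {R : realType} (mu : {measure set T -> \bar R}) (P : probability T R)
    (p : T -> R) : Prop :=
  [/\ measurable_fun setT p,
      forall x, (0 <= p x)%R &
      forall A, measurable A -> P A = \int[mu]_(x in A) (p x)%:E].

Definition hellinger_affinity {d : measure_display} {T : measurableType d}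
    {R : realType} (mu : {measure set T -> \bar R}) (p q : T -> R) : R :=
  (\int[mu]_x Num.sqrt (p x * q x))%R.

(* [+oo] when the affinity is 0, since [0^-1 = +oo] and [lne +oo = +oo]. *)
Definition bhattacharyya_div {d : measure_display} {T : measurableType d}
    {R : realType} (mu : {measure set T -> \bar R}) (p q : T -> R) : \bar R :=
  2%:E * lne ((hellinger_affinity mu p q)%:E^-1).

(* The extended-real conventions [0^-1 = +oo], [0 * +oo = 0 * -oo = 0] make the
   integrand 0 where p = 0, and +oo where p > 0 = q. *)
Definition relative_entropy {d : measure_display} {T : measurableType d}
    {R : realType} (mu : {measure set T -> \bar R}) (p q : T -> R) : \bar R :=
  \int[mu]_x ((p x)%:E * lne ((p x)%:E / (q x)%:E)).

Definition mutually_independent {d d' : measure_display}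
    {Omega : measurableType d} {T : measurableType d'} {R : realType}
    (Pr : probability Omega R) (n : nat) (X : 'I_n -> {RV Pr >-> T}) : Prop :=
  forall (J : {set 'I_n}) (B : 'I_n -> set T),
    (forall i, i \in J -> measurable (B i)) ->
    Pr (\bigcap_(i in [set` J]) (X i @^-1` B i)) =
    \prod_(i in J) Pr (X i @^-1` B i).

Definition iid {d d' : measure_display}
    {Omega : measurableType d} {T : measurableType d'} {R : realType}
    (Pr : probability Omega R) (P : probability T R) (n : nat)
    (X : 'I_n -> {RV Pr >-> T}) : Prop :=
  mutually_independent X /\
  forall i A, measurable A -> distribution Pr (X i) A = P A.

(* [thetahat] maps every sample to some maximizer of the penalized
   log-likelihood, with [log 0 = -oo]; how ties are broken is unconstrained. *)
Definition is_penalized_mle {T Theta : Type} {R : realType} (n : nat)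
    (p_ : Theta -> T -> R) (L : Theta -> R)
    (thetahat : ('I_n -> T) -> Theta) : Prop :=
  forall (x : 'I_n -> T) (theta : Theta),
    \sum_(i < n) lne (p_ theta (x i))%:E - (L theta)%:E <=
    \sum_(i < n) lne (p_ (thetahat x) (x i))%:E - (L (thetahat x))%:E.

Definition resolvability {d : measure_display} {T : measurableType d}
    {R : realType} {Theta : Type} (mu : {measure set T -> \bar R}) (n : nat)
    (p : T -> R) (p_ : Theta -> T -> R) (L : Theta -> R) : \bar R :=
  ereal_inf [set relative_entropy mu p (p_ theta) + (L theta / n%:R)%:E
            | theta in [set: Theta]].

(* Main.v *)
Require Import Defs.
From HB Require Import structures.
From mathcomp Require Import all_boot all_order all_algebra.
From mathcomp Require Import all_classical all_reals all_analysis.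
From mathcomp Require Import measurable_realfun ring lra.

Import Order.TTheory GRing.Theory Num.Theory.
Import numFieldNormedType.Exports.

Local Open Scope classical_set_scope.
Local Open Scope ring_scope.
Local Open Scope ereal_scope.

(** Write [A_t] for the Hellinger affinity of [p] and [p_t], so that the
Bhattacharyya divergence is [-2 log A_t], and put [kappa = (1 - alpha) n].
To each parameter [t] attach the random variable
[Z_t = e^(- L t / 2) A_t^(- kappa) prod_i sqrt (p_t(X_i) / p(X_i))].
Under [P] the factors are independent with mean [A_t], hence
[E Z_t <= e^(- L t / 2) A_t^(alpha n)], with equality when [A_t > 0], and the
expectation of [W = sum_t Z_t] is at most the sum [S] inside the logarithm of the
theorem.

Taking logarithms, [kappa D_B(P, P_t)] equals
[2 log Z_t + (L t - sum_i log p_t(X_i)) + sum_i log p(X_i)]. At the penalized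
maximum likelihood estimate the middle term is at most its value at any fixed
[theta], and [log Z_t <= log W <= log s + W / s - 1] for every [s > 0]. So
[kappa D_B(P, P_thetahat) <= 2 (log s - 1) + (2 / s) W + L theta +
sum_i log (p(X_i) / p_theta(X_i))] (lemma [mle_pointwise]). The linear bound on the
logarithm replaces the inequality of Jensen: taking expectations gives, for every
[s >= S], [kappa E D_B <= 2 log s + L theta + n D(P || P_theta)] (lemma
[expectation_bound]). Taking [s = S] and the infimum over [theta] is the theorem.

The estimator is an arbitrary function, so [D_B(P, P_thetahat)] may fail to be
measurable; its integral is then the supremum of the integrals of the simple functions
below it, and it suffices that the upper bound is measurable
(lemma [le_ge0_integralT]). The bound holds at every sample and not just almost
surely, because the two sources of degeneracy are absorbed by infinite values:
the log ratio is [+oo] as soon as [p] or [p_theta] vanishes, and [Z_t] has the weight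
[+oo] when [A_t = 0]. When [S = 0] the theorem holds because [D(P || P_theta)] is
infinite for every [theta]: otherwise [s] could tend to [0] in the bound. *)

(** * Integrals with a weight *)

Section weighted_integral.
Context {d d' : measure_display} {U : measurableType d}
  {T : measurableType d'} {R : realType} {nu : {measure set U -> \bar R}}
  {P : {measure set T -> \bar R}} {W : U -> R} {X : U -> T} {c : R}.
Hypotheses (mW : measurable_fun setT W) (W0 : forall u, (0 <= W u)%R)
  (mX : measurable_fun setT X) (c0 : (0 <= c)%R)
  (WP : forall B, measurable B ->
    \int[nu]_(u in X @^-1` B) (W u)%:E = c%:E * P B).
Context {g : T -> \bar R}.
Hypotheses (mg : measurable_fun [set: T] g) (g0 : forall x, 0 <= g x).

Import HBNNSimple.

Lemma weighted_integral_nnsfun (h : {nnsfun T >-> R}) :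
  \int[nu]_u ((W u)%:E * (h (X u))%:E) = c%:E * \int[P]_x (h x)%:E.
Proof.
pose I y u : R := \1_(h @^-1` [set y]) (X u).
have mB y : measurable (h @^-1` [set y]) by [].
have mI y : measurable_fun setT (fun u => (W u * I y u)%:E).
  apply/measurable_EFinP/measurable_funM => //.
  exact: (measurableT_comp (measurable_indic (mB y)) mX).
have ypos y u : 0 <= y%:E * (W u * I y u)%:E.
  rewrite EFinM muleCA mule_ge0 ?lee_fin ?W0//.
  exact: nnfun_muleindic_ge0.
transitivity (\int[nu]_u (\sum_(y \in range h) y%:E * (W u * I y u)%:E)).
  apply: eq_integral => u _; rewrite [h (X u)]fimfunE -fsumEFin//.
  rewrite muleC ge0_mule_fsuml => [|y]; last exact: nnfun_muleindic_ge0.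
  by apply: eq_fsbigr => y _; rewrite EFinM [in RHS]EFinM -muleA [X in _ * X]muleC.
rewrite ge0_integral_fsum//; last by move=> y; exact: measurable_funeM.
rewrite integralT_nnsfun sintegralE ge0_mule_fsumr; last first.
  by move=> y; exact: nnsfun_mulemu_ge0.
apply: eq_fsbigr => y /set_mem[x _ <-].
rewrite ge0_integralZl//; last 2 first.
- by move=> u _; rewrite lee_fin mulr_ge0.
- by rewrite lee_fin.
rewrite muleCA -WP//; congr (_ * _).
rewrite [RHS]integral_mkcond; apply: eq_integral => u _.
by rewrite epatch_indic EFinM.
Qed.

(** If the measure with density [W] is pushed forward by [X] to [c * P], then this
holds for integrals of nonnegative functions too. Both the passage from [P] to its
density ([X] the identity) and the factorization of expectations under independence
([W] the product of the other factors) are instances. *)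
Lemma ge0_weighted_integral :
  \int[nu]_u ((W u)%:E * g (X u)) = c%:E * \int[P]_x g x.
Proof.
pose h := nnsfun_approx measurableT mg.
have mh k : measurable_fun setT (EFin \o h k) by exact/measurable_EFinP.
have mhX k : measurable_fun setT (fun u => (W u)%:E * (h k (X u))%:E).
  apply: emeasurable_funM; first exact/measurable_EFinP.
  exact: (measurableT_comp (mh k) mX).
have hg x : (h k x)%:E @[k --> \oo] --> g x by exact: cvg_nnsfun_approx.
have ndh x : {homo (fun k => h k x) : k l / (k <= l)%N >-> (k <= l)%R}.
  by move=> k l kl; exact/lefP/nd_nnsfun_approx.
have h0 k x : (0 <= h k x)%R by [].
rewrite -ge0_integralZl//.
transitivity (limn (fun k => \int[nu]_u ((W u)%:E * (h k (X u))%:E))).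
  rewrite -monotone_convergence//; last 2 first.
  - by move=> k u _; rewrite mule_ge0 ?lee_fin.
  - by move=> u _ k l kl; rewrite lee_wpmul2l ?lee_fin// ndh.
  by apply: eq_integral => u _; apply/esym/cvg_lim => //; exact: cvgeZl.
rewrite (_ : (fun k => _) = fun k => \int[P]_x (c%:E * (h k x)%:E)); last first.
  apply/funext => k; rewrite weighted_integral_nnsfun ge0_integralZl//.
    exact: mh.
  by move=> x _; rewrite lee_fin.
rewrite -monotone_convergence//.
- by apply: eq_integral => x _; apply/cvg_lim => //; exact: cvgeZl.
- by move=> k; apply: measurable_funeM; exact: mh.
- by move=> k x _; rewrite mule_ge0 ?lee_fin.
- by move=> x _ k l kl; rewrite lee_wpmul2l ?lee_fin// ndh.
Qed.

End weighted_integral.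

(** * Densities and independence *)

Section density.
Context {d : measure_display} {T : measurableType d} {R : realType}
  {mu : {measure set T -> \bar R}} {P : probability T R} {p : T -> R}.
Hypothesis hp : is_density mu P p.

Lemma ge0_integral_density (g : T -> \bar R) :
  measurable_fun setT g -> (forall x, 0 <= g x) ->
  \int[P]_x g x = \int[mu]_x ((p x)%:E * g x).
Proof.
case: hp => mp p0 pP mg g0.
rewrite (ge0_weighted_integral (P := P) (c := 1) mp p0 (@measurable_id _ _ _))//.
  by rewrite mul1e.
by move=> B mB; rewrite mul1e; exact/esym/pP.
Qed.

Lemma integral_density (h : T -> \bar R) : measurable_fun setT h ->
  \int[P]_x h x = \int[mu]_x ((p x)%:E * h x).
Proof.
case: hp => mp p0 pP mh.
rewrite [LHS]integralE [RHS]integralE !ge0_integral_density//; last 2 first.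
- exact: measurable_funeneg.
- exact: measurable_funepos.
by congr (_ - _); apply: eq_integral => x _;
  rewrite ?funeposE ?funenegE -?muleN maxe_pMr ?mule0 ?lee_fin.
Qed.

Lemma integral_density1 : \int[mu]_x (p x)%:E = 1.
Proof. by case: hp => _ _ <-//; rewrite probability_setT. Qed.

End density.

(** Independence is given on indicators; they are replaced by the functions [g i] one
coordinate at a time, [ge0_weighted_integral] being applied with the product of the
other coordinates as weight. *)
Lemma mutually_independent_integral_prod {d d' : measure_display}
    {Omega : measurableType d} {T : measurableType d'} {R : realType}
    (Pr : probability Omega R) (n : nat) (X : 'I_n -> {RV Pr >-> T})
    (g : 'I_n -> T -> R) (a : 'I_n -> R) :
  mutually_independent X ->
  (forall i, measurable_fun setT (g i)) -> (forall i x, (0 <= g i x)%R) ->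
  (forall i, \int[Pr]_w (g i (X i w))%:E = (a i)%:E) ->
  \int[Pr]_w (\prod_i g i (X i w))%:E = (\prod_i a i)%:E.
Proof.
move=> indep mg g0 ga.
have mX i : measurable_fun setT (X i) by exact: measurable_funPT.
have mXpre i B : measurable B -> measurable (X i @^-1` B).
  by move=> mB; rewrite -[X in measurable X]setTI; exact: mX.
(* the coordinates that are not yet known to factor are indicators *)
suff: forall k, (k <= n)%N -> forall (g : 'I_n -> T -> R) (a : 'I_n -> R),
    (forall i, measurable_fun setT (g i)) -> (forall i x, (0 <= g i x)%R) ->
    (forall i, \int[Pr]_w (g i (X i w))%:E = (a i)%:E) ->
    (forall i : 'I_n, (k <= i)%N -> exists2 B, measurable B & g i = \1_B) ->
    \int[Pr]_w (\prod_i g i (X i w))%:E = (\prod_i a i)%:E.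
  move=> /(_ n (leqnn n) g a mg g0 ga); apply=> i.
  by rewrite leqNgt ltn_ord.
elim=> [|k IH] kn {mg g0 ga}g {}a mg g0 ga gB.
  have /choice[B mgB] : forall i, exists B, measurable B /\ g i = \1_B.
    by move=> i; have [B mB gi] := gB i isT; exists B.
  have aB i : (a i)%:E = Pr (X i @^-1` B i).
    have [mB gi] := mgB i.
    rewrite -ga gi (eq_integral (fun w => (\1_(X i @^-1` B i) w)%:E))//.
    by rewrite integral_indic ?setIT//; exact: mXpre.
  have [mB gi] : (forall i, measurable (B i)) /\ (forall i, g i = \1_(B i)).
    by split => i; have [] := mgB i.
  rewrite -prodEFin.
  under [RHS]eq_bigr do rewrite aB.
  have := indep [set: 'I_n]%SET B (fun i _ => mB i).
  rewrite [X in _ = X](eq_bigl xpredT); last by move=> i; rewrite finset.in_setT.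
  move=> <-.
  have mXB : measurable (\bigcap_(i in [set` [set: 'I_n]%SET]) (X i @^-1` B i)).
    by apply: fin_bigcap_measurable => // i _; exact: mXpre.
  have := integral_indic Pr measurableT mXB; rewrite setIT => <-.
  apply: eq_integral => w _.
  congr EFin; rewrite indicE.
  case: (boolP (w \in _)) => [/set_mem wB|wB].
    rewrite big1// => i _; rewrite gi indicE mem_set//.
    by apply: wB; rewrite /= finset.in_setT.
  have /existsNP[i wBi] : ~ forall i, B i (X i w).
    by move=> wB'; move/negP: wB; apply; apply/mem_set => i _; exact: wB'.
  by rewrite (bigD1 i)//= gi indicE memNset// mul0r.
pose k0 := Ordinal kn.
pose W w := (\prod_(i | i != k0) g i (X i w))%R.
transitivity (\int[Pr]_w ((W w)%:E * (EFin \o g k0) (X k0 w))).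
  by apply: eq_integral => w _; rewrite (bigD1 k0)//= EFinM muleC.
rewrite (ge0_weighted_integral (P := distribution Pr (X k0))
  (c := (\prod_(i | i != k0) a i)%R)).
- rewrite ge0_integral_distribution//.
  + by rewrite [in RHS](bigD1 k0)//= EFinM muleC -ga.
  + exact/measurable_EFinP.
  + by move=> y; rewrite lee_fin.
- rewrite /W; under eq_fun do rewrite big_mkcond.
  apply: measurable_prod => i _; case: (i != k0) => //.
  exact: (measurableT_comp (mg i)).
- by move=> w; exact: prodr_ge0.
- exact: mX.
- apply: prodr_ge0 => i _; rewrite -lee_fin -ga.
  by apply: integral_ge0 => w _; rewrite lee_fin.
- move=> B mB.
  pose g' i := if i == k0 then \1_B else g i.
  pose a' i := if i == k0 then fine (Pr (X k0 @^-1` B)) else a i.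
  have mXB : measurable (X k0 @^-1` B) by exact: mXpre.
  transitivity (\int[Pr]_w (\prod_i g' i (X i w))%:E).
    rewrite integral_mkcond; apply: eq_integral => w _.
    rewrite epatch_indic (bigD1 k0)//= /g' eqxx EFinM muleC; congr (_ * _%:E).
    by apply: eq_bigr => i /negPf ->.
  rewrite (IH (ltnW kn) g' a').
  + rewrite (bigD1 k0)//= /a' eqxx EFinM fineK ?fin_num_measure// muleC.
    by congr (_%:E * _); apply: eq_bigr => i /negPf ->.
  + by move=> i; rewrite /g'; case: ifP.
  + by move=> i x; rewrite /g'; case: ifP.
  + move=> i; rewrite /g' /a'; case: eqP => [->|//].
    rewrite fineK ?fin_num_measure//.
    rewrite (eq_integral (fun w => (\1_(X k0 @^-1` B) w)%:E))//.
    by rewrite integral_indic ?setIT.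
  + move=> i ki; rewrite /g'; case: eqP => [_|/eqP ik0]; first by exists B.
    by apply: gB; rewrite ltn_neqAle ki andbT eq_sym.
- exact/measurable_EFinP.
- by move=> x; rewrite lee_fin.
Qed.

(** * Nonmeasurable integrands and countable sums *)

(** The integral of a nonnegative function, measurable or not, is by definition a
supremum over the simple functions below it. *)
Lemma le_ge0_integralT {d : measure_display} {T : measurableType d}
    {R : realType} (mu : {measure set T -> \bar R}) (f g : T -> \bar R) :
  (forall x, 0 <= f x) -> (forall x, f x <= g x) ->
  \int[mu]_x f x <= \int[mu]_x g x.
Proof.
move=> f0 fg; rewrite !ge0_integralTE//; last first.
  by move=> x; exact: le_trans (f0 x) (fg x).
apply: le_ereal_sup => _ [h hf <-]; exists h => // x.
exact: le_trans (hf x) (fg x).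
Qed.

Section countable_sum.
Context {R : realType} {I : countType}.

Lemma esum_pickle (a : I -> \bar R) : (forall i, 0 <= a i) ->
  \esum_(i in [set: I]) a i = \sum_(k <oo) oapp a 0 (pickle_inv k).
Proof.
move=> a0; have b0 k : 0 <= oapp a 0 (pickle_inv k : option I).
  by case: pickle_inv => [i|]/=.
rewrite nneseries_esumT// (esumID (range (@pickle I)))// !setTI.
rewrite [X in _ = _ + X]esum1 ?adde0; last first.
  move=> k nk; have := @pickle_invK I k.
  by case: pickle_inv => //= i ik; case: nk; exists i.
rewrite (@reindex_esum _ _ _ [set: I] (range (@pickle I)) pickle).
  by apply: eq_esum => i _; rewrite pickleK_inv.
by apply: inj_bij => i j _ _; exact: (pcan_inj pickleK_inv).
Qed.

Context {d : measure_display} {T : measurableType d}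
  (mu : {measure set T -> \bar R}) (f : I -> T -> \bar R).
Hypotheses (mf : forall i, measurable_fun setT (f i))
  (f0 : forall i x, 0 <= f i x).

Let F k x := oapp (f ^~ x) 0 (pickle_inv k).

Let mF k : measurable_fun setT (F k).
Proof. by rewrite /F; case: pickle_inv => [i|]//=. Qed.

Let F0 k x : 0 <= F k x.
Proof. by rewrite /F; case: pickle_inv => [i|]//=. Qed.

Lemma measurable_fun_esum :
  measurable_fun setT (fun x => \esum_(i in [set: I]) f i x).
Proof.
under eq_fun do rewrite esum_pickle//.
by apply: ge0_emeasurable_sum => [k x _ _|k _]; [exact: F0|exact: mF].
Qed.

Lemma ge0_integral_esum :
  \int[mu]_x (\esum_(i in [set: I]) f i x) =
  \esum_(i in [set: I]) \int[mu]_x f i x.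
Proof.
rewrite (eq_integral (fun x => \sum_(k <oo) F k x)); last first.
  by move=> x _; rewrite esum_pickle.
rewrite integral_nneseries// esum_pickle//; last first.
  by move=> i; exact: integral_ge0.
apply: eq_eseriesr => k _; rewrite /F; case: pickle_inv => [i|]//=.
by rewrite integral0.
Qed.

End countable_sum.

Lemma le_esum1 {R : realType} {I : choiceType} (a : I -> \bar R) (i : I) :
  a i <= \esum_(j in [set: I]) a j.
Proof. by apply: esum_ge; exists [set i]; rewrite ?fsbig_set1//; split. Qed.

(** * Affinity and relative entropy of two densities *)

(** [sqrt (q / p)], written so that it is the exponential of half the log ratio. *)
Definition sqrt_ratio {T : Type} {R : realType} (p q : T -> R) (x : T) : R :=
  if (0 < p x)%R && (0 < q x)%R then expR ((ln (q x) - ln (p x)) / 2) else 0%R.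

(** [log (p / q)], extended by [+oo] also where [p] vanishes. That set is null for the
measure with density [p], and this convention makes the bounds below hold
everywhere. *)
Definition log_ratio {T : Type} {R : realType} (p q : T -> R) (x : T) : \bar R :=
  if (0 < p x)%R && (0 < q x)%R then (ln (p x) - ln (q x))%:E else +oo.

Section two_densities.
Context {d : measure_display} {T : measurableType d} {R : realType}
  {mu : {measure set T -> \bar R}} {P Q : probability T R} {p q : T -> R}.
Hypotheses (hp : is_density mu P p) (hq : is_density mu Q q).

Let p0 x : (0 <= p x)%R. Proof. by case: hp. Qed.
Let q0 x : (0 <= q x)%R. Proof. by case: hq. Qed.
Let mp : measurable_fun setT p. Proof. by case: hp. Qed.
Let mq : measurable_fun setT q. Proof. by case: hq. Qed.

Local Notation A := (hellinger_affinity mu p q).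

(** The arithmetic-geometric mean inequality, integrated. *)
Lemma integral_sqrt_le1 : \int[mu]_x (Num.sqrt (p x * q x))%:E <= 1.
Proof.
have -> : 1 = \int[mu]_x (2^-1%:E * ((p x)%:E + (q x)%:E)) :> \bar R.
  rewrite ge0_integralZl//; last 2 first.
  - by apply: emeasurable_funD; exact/measurable_EFinP.
  - by move=> x _; rewrite adde_ge0 ?lee_fin.
  rewrite ge0_integralD//; last 4 first.
  - by move=> x _; rewrite lee_fin.
  - exact/measurable_EFinP.
  - by move=> x _; rewrite lee_fin.
  - exact/measurable_EFinP.
  rewrite (integral_density1 hp) (integral_density1 hq).
  rewrite -[RHS]/((2^-1 * (1 + 1))%R%:E).
  by congr EFin; lra.
apply: le_ge0_integralT => x; first by rewrite lee_fin sqrtr_ge0.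
rewrite -EFinD -EFinM lee_fin.
rewrite sqrtrM//; have := sqr_ge0 (Num.sqrt (p x) - Num.sqrt (q x))%R.
by rewrite sqrrB !sqr_sqrtr//; lra.
Qed.

Lemma affinity_ge0 : (0 <= A)%R.
Proof. by apply: Rintegral_ge0 => x _. Qed.

Lemma EFin_affinity : A%:E = \int[mu]_x (Num.sqrt (p x * q x))%:E.
Proof.
rewrite /hellinger_affinity /Rintegral fineK// ge0_fin_numE; last first.
  by apply: integral_ge0 => x _; rewrite lee_fin.
exact: le_lt_trans integral_sqrt_le1 (ltry 1).
Qed.

Lemma bhattacharyya_div_ge0 : 0 <= bhattacharyya_div mu p q.
Proof.
rewrite /bhattacharyya_div mule_ge0 ?lee_fin// lne_ge0 inver.
case: eqP => [_|/eqP A0]; first exact: leey.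
have A1 : (A <= 1)%R by rewrite -lee_fin EFin_affinity integral_sqrt_le1.
by rewrite lee_fin invf_ge1// lt0r A0 affinity_ge0.
Qed.

Let measurable_pos :
  measurable_fun setT (fun x => (0 < p x)%R && (0 < q x)%R).
Proof. by apply: measurable_and; exact: measurable_fun_ltr. Qed.

Let mlnp : measurable_fun setT (fun x => ln (p x)).
Proof. exact: measurableT_comp (@measurable_ln R) mp. Qed.

Let mlnq : measurable_fun setT (fun x => ln (q x)).
Proof. exact: measurableT_comp (@measurable_ln R) mq. Qed.

Lemma measurable_sqrt_ratio : measurable_fun setT (sqrt_ratio p q).
Proof.
apply: measurable_fun_ifT => //.
apply: (measurableT_comp (@measurable_expR R)).
by apply: measurable_funM => //; exact: measurable_funB.
Qed.

Lemma sqrt_ratio_ge0 x : (0 <= sqrt_ratio p q x)%R.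
Proof. by rewrite /sqrt_ratio; case: ifP => // _; exact: expR_ge0. Qed.

Lemma integral_sqrt_ratio : \int[P]_x (sqrt_ratio p q x)%:E = A%:E.
Proof.
rewrite (ge0_integral_density hp); last 2 first.
- exact/measurable_EFinP/measurable_sqrt_ratio.
- by move=> x; rewrite lee_fin sqrt_ratio_ge0.
rewrite EFin_affinity; apply: eq_integral => x _; rewrite -EFinM /sqrt_ratio.
have := p0 x; rewrite le_eqVlt => /predU1P[<-|px].
  by rewrite !mul0r sqrtr0.
have := q0 x; rewrite le_eqVlt => /predU1P[<-|qx].
  by rewrite ltxx andbF !mulr0 sqrtr0.
rewrite px qx /=; congr EFin.
rewrite -[X in (X * expR _)%R](lnK px) -[X in Num.sqrt (X * _)](lnK px).
rewrite -[X in Num.sqrt (_ * X)](lnK qx) -!expRD.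
set u := ln (p x); set v := ln (q x).
have -> : (expR (u + v) = expR ((u + v) / 2) ^+ 2)%R.
  by rewrite expr2 -expRD; congr expR; lra.
rewrite sqrtr_sqr ger0_norm ?expR_ge0//.
by congr expR; lra.
Qed.

Lemma measurable_log_ratio : measurable_fun setT (log_ratio p q).
Proof.
apply: measurable_fun_ifT => //.
by apply/measurable_EFinP; exact: measurable_funB.
Qed.

Lemma relative_entropyE : relative_entropy mu p q = \int[P]_x log_ratio p q x.
Proof.
rewrite (integral_density hp)//; last exact: measurable_log_ratio.
apply: eq_integral => x _; have := p0 x; rewrite le_eqVlt => /predU1P[<-|px].
  by rewrite !mul0e.
rewrite /log_ratio px /=; congr (_ * _).
have := q0 x; rewrite le_eqVlt => /predU1P[<-|qx].
  by rewrite ltxx inve0 gt0_muley ?lte_fin.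
by rewrite qx inver gt_eqF// -EFinM lne_EFin ?divr_gt0// ln_div.
Qed.

(** Where it is negative, [log (p / q)] satisfies [- log (p / q) <= q / p], and [q / p]
has integral at most 1 under [P]. *)
Lemma integral_log_ratio_neg : \int[P]_x (log_ratio p q)^\- x <= 1.
Proof.
rewrite (ge0_integral_density hp)//; last first.
  exact/measurable_funeneg/measurable_log_ratio.
rewrite -(integral_density1 hq); apply: le_ge0_integralT => x.
  by rewrite mule_ge0 ?lee_fin.
rewrite funenegE /log_ratio; case: ifPn => [/andP[px qx]|_]; last first.
  by rewrite /maxe /= ltNye /= mule0 lee_fin.
rewrite -EFinN -EFin_max -EFinM lee_fin.
rewrite mulrC -ler_pdivlMr// ge_max divr_ge0// andbT opprB -ln_div//.
exact/ltW/ln_sublinear/divr_gt0.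
Qed.

(** The negative part is integrable by [integral_log_ratio_neg], so a finite relative
entropy leaves no room for an infinite positive part. *)
Lemma integrable_log_ratio : relative_entropy mu p q < +oo ->
  P.-integrable setT (log_ratio p q).
Proof.
rewrite relative_entropyE integralE => fin.
have mh := measurable_log_ratio.
have neg_fin : \int[P]_x (log_ratio p q)^\- x < +oo.
  exact: le_lt_trans integral_log_ratio_neg (ltry 1).
apply/integrableP; split => //.
have -> : \int[P]_x `|log_ratio p q x| =
    \int[P]_x (log_ratio p q)^\+ x + \int[P]_x (log_ratio p q)^\- x.
  rewrite -ge0_integralD//; [|exact: measurable_funepos|exact: measurable_funeneg].
  by apply: eq_integral => x _; rewrite -/((abse \o log_ratio p q) x) fune_abse.
rewrite lte_add_pinfty//.
move: fin; case: (\int[P]_x (log_ratio p q)^\+ x) => [r|//|//]; first by rewrite ltry.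
move: neg_fin; case: (\int[P]_x (log_ratio p q)^\- x) (integral_ge0) => //.
Qed.

End two_densities.

(** * Expectations over an iid sample *)

Section iid_integral.
Context {d d' : measure_display} {Omega : measurableType d}
  {T : measurableType d'} {R : realType} {Pr : probability Omega R}
  {P : probability T R} {n : nat} {X : 'I_n -> {RV Pr >-> T}}.
Hypothesis hX : iid P X.

Lemma integral_iid (i : 'I_n) (f : T -> \bar R) : measurable_fun setT f ->
  \int[Pr]_w f (X i w) = \int[P]_x f x.
Proof.
move=> mf.
have ge0 (g : T -> \bar R) : measurable_fun setT g -> (forall x, 0 <= g x) ->
    \int[Pr]_w g (X i w) = \int[P]_x g x.
  move=> mg g0; rewrite -(ge0_integral_distribution (X i))//.
  by apply: eq_measure_integral => B mB _; exact: hX.2.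
rewrite [LHS]integralE [RHS]integralE; congr (_ - _).
  rewrite -(ge0 f^\+ (measurable_funepos mf) (funepos_ge0 f)).
  by apply: eq_integral => w _; rewrite !funeposE.
rewrite -(ge0 f^\- (measurable_funeneg mf) (funeneg_ge0 f)).
by apply: eq_integral => w _; rewrite !funenegE.
Qed.

Lemma integrable_iid (i : 'I_n) (f : T -> \bar R) :
  P.-integrable setT f -> Pr.-integrable setT (fun w => f (X i w)).
Proof.
move=> /integrableP[mf fin]; apply/integrableP; split.
  exact: (measurableT_comp mf (measurable_funPT (X i))).
by rewrite (integral_iid i (fun x => `|f x|))//; exact: measurableT_comp.
Qed.

End iid_integral.

(** * The penalized maximum likelihood estimate *)

Section penalized_mle.
Context {R : realType} {d : measure_display} {T : measurableType d}
  {mu : {measure set T -> \bar R}} {P : probability T R} {p : T -> R}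
  (hp : is_density mu P p)
  {Theta : countType} {P_ : Theta -> probability T R} {p_ : Theta -> T -> R}
  (hp_ : forall theta, is_density mu (P_ theta) (p_ theta))
  (L : Theta -> R) {n : nat} (n_gt0 : (0 < n)%N)
  {d' : measure_display} {Omega : measurableType d'}
  {Pr : probability Omega R} {X : 'I_n -> {RV Pr >-> T}} (hX : iid P X)
  {thetahat : ('I_n -> T) -> Theta}
  (hthetahat : is_penalized_mle p_ L thetahat)
  {alpha : R} (alpha_lt1 : (alpha < 1)%R).

Let A theta := hellinger_affinity mu p (p_ theta).
Let kappa : R := ((1 - alpha) * n%:R)%R.

Let kappa_gt0 : (0 < kappa)%R.
Proof. by rewrite mulr_gt0 ?subr_gt0 ?ltr0n. Qed.

Let A_ge0 theta : (0 <= A theta)%R.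
Proof. exact: affinity_ge0. Qed.

(** The factor of the tilted likelihood that does not depend on the sample; it is [+oo]
when the affinity vanishes. *)
Definition tilt_weight theta : \bar R :=
  (expR (- (2^-1 * L theta)))%:E / (A theta `^ kappa)%:E.

Lemma tilt_weight_ge0 theta : 0 <= tilt_weight theta.
Proof.
by rewrite /tilt_weight mule_ge0 ?lee_fin ?expR_ge0// inve_ge0 lee_fin powR_ge0.
Qed.

(** An equality unless the affinity is 0; in that case the left-hand side is
[+oo * 0 = 0], whereas the right-hand side is positive for [alpha = 0]. *)
Lemma tilt_weight_affinity theta : tilt_weight theta * (A theta ^+ n)%:E <=
  (expR (- (2^-1 * L theta)) * A theta `^ (alpha * n%:R))%:E.
Proof.
rewrite /tilt_weight; have := A_ge0 theta; rewrite le_eqVlt => /predU1P[<-|A_gt0].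
  by rewrite expr0n gtn_eqF// mule0 lee_fin mulr_ge0 ?expR_ge0 ?powR_ge0.
rewrite inver gt_eqF ?powR_gt0//=.
rewrite -(EFinM (expR _)) -(EFinM (expR _ * _)%R) lee_fin -mulrA ler_wpM2l ?expR_ge0//.
rewrite -powR_mulrn// -powRN -powRD; last by rewrite (gt_eqF A_gt0) implybT.
by have -> : (- kappa + n%:R = alpha * n%:R)%R by rewrite /kappa; ring.
Qed.

(** The random variable [Z_t] of the introduction, as a function of the sample. *)
Definition tilted_likelihood theta (x : 'I_n -> T) : \bar R :=
  tilt_weight theta * (\prod_i sqrt_ratio p (p_ theta) (x i))%:E.

Lemma tilted_likelihood_ge0 theta x : 0 <= tilted_likelihood theta x.
Proof.
rewrite mule_ge0 ?tilt_weight_ge0// lee_fin prodr_ge0// => i _.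
exact: sqrt_ratio_ge0.
Qed.

Let mprod theta : measurable_fun setT
  (fun w => (\prod_i sqrt_ratio p (p_ theta) (X i w))%:E).
Proof.
apply/measurable_EFinP/measurable_prod => i _.
exact: measurableT_comp (measurable_sqrt_ratio hp (hp_ theta)) _.
Qed.

Lemma measurable_tilted_likelihood theta :
  measurable_fun setT (fun w => tilted_likelihood theta (fun i => X i w)).
Proof. exact: measurable_funeM. Qed.

Lemma integral_tilted_likelihood theta :
  \int[Pr]_w tilted_likelihood theta (fun i => X i w) =
  tilt_weight theta * (A theta ^+ n)%:E.
Proof.
rewrite ge0_integralZl//; last 2 first.
- by move=> w _; rewrite lee_fin prodr_ge0// => i _; exact: sqrt_ratio_ge0.
- exact: tilt_weight_ge0.
have mr := measurable_sqrt_ratio hp (hp_ theta).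
rewrite (mutually_independent_integral_prod Pr n X
  (fun=> sqrt_ratio p (p_ theta)) (fun=> A theta) hX.1)//.
- by rewrite prodr_const card_ord.
- by move=> _ x; exact: sqrt_ratio_ge0.
- move=> i.
  rewrite (integral_iid hX i (fun x => (sqrt_ratio p (p_ theta) x)%:E)).
    exact: integral_sqrt_ratio (hp_ theta).
  exact/measurable_EFinP.
Qed.

Let W w := \esum_(theta in [set: Theta]) tilted_likelihood theta (fun i => X i w).

Let mW : measurable_fun setT W.
Proof.
apply: measurable_fun_esum; first exact: measurable_tilted_likelihood.
by move=> theta w; exact: tilted_likelihood_ge0.
Qed.

Lemma integral_sum_tilted_likelihood_le : \int[Pr]_w W w <=
  \esum_(theta in [set: Theta])
    (expR (- (2^-1 * L theta)) * A theta `^ (alpha * n%:R))%:E.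
Proof.
rewrite ge0_integral_esum//.
- apply: le_esum => theta _; rewrite integral_tilted_likelihood.
  exact: tilt_weight_affinity.
- exact: measurable_tilted_likelihood.
- by move=> theta w; exact: tilted_likelihood_ge0.
Qed.

(** The maximality of the estimate is combined with [u - ln s <= expR u / s - 1], where
[expR u] is the tilted likelihood of the estimate, one of the terms of the sum. *)
Lemma mle_pointwise (s : R) (theta : Theta) (x : 'I_n -> T) : (0 < s)%R ->
  kappa%:E * bhattacharyya_div mu p (p_ (thetahat x)) <=
  (2 * (ln s - 1) + L theta)%:E +
  (2 / s)%:E * (\esum_(t in [set: Theta]) tilted_likelihood t x) +
  \sum_(i < n) log_ratio p (p_ theta) (x i).
Proof.
move=> s_gt0; set S := esum _ _; set that := thetahat x.
have S_ge : tilted_likelihood that x <= S by exact: le_esum1.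
have S0 : 0 <= S by exact: le_trans (tilted_likelihood_ge0 _ _) S_ge.
have s2 : (0 < 2 / s)%R by rewrite divr_gt0.
have hNy i : log_ratio p (p_ theta) (x i) != -oo.
  by rewrite /log_ratio; case: ifP.
(* if some log ratio is infinite, so is the right-hand side *)
have [/forallP pos|/forallPn[i hi]] := boolP
    [forall i, (0 < p (x i))%R && (0 < p_ theta (x i))%R]; last first.
  rewrite [X in _ <= _ + X](_ : _ = +oo).
    rewrite addey ?leey//.
    rewrite -ltNye (lt_le_trans (ltNyr (2 * (ln s - 1) + L theta)))// leeDl//.
    by rewrite mule_ge0// lee_fin ltW.
  apply/(esum_eqyP _ (fun j _ => hNy j)).
  by exists i; split; rewrite ?mem_index_enum// /log_ratio (negPf hi).
have sumE : \sum_(i < n) log_ratio p (p_ theta) (x i) =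
    (\sum_(i < n) (ln (p (x i)) - ln (p_ theta (x i))))%:E.
  by rewrite -sumEFin; apply: eq_bigr => i _; rewrite /log_ratio pos.
have := hthetahat x theta; rewrite -/that.
rewrite (eq_bigr (fun i => (ln (p_ theta (x i)))%:E)); last first.
  by move=> i _; rewrite lne_EFin//; case/andP: (pos i).
rewrite sumEFin => mle.
(* a vanishing factor would make the likelihood of the maximizer -oo *)
have that_gt0 i : (0 < p_ that (x i))%R.
  rewrite ltNge; apply/negP => le0.
  move: mle; rewrite [X in _ <= X - _](bigD1 i)//= le0 !addNye.
  by rewrite -EFinB leeNy_eq.
move: mle; rewrite [X in _ <= X - _](eq_bigr (fun i => (ln (p_ that (x i)))%:E));
  last by move=> i _; rewrite lne_EFin.
rewrite sumEFin -!EFinB lee_fin => mle.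
rewrite sumE /bhattacharyya_div -/(A that).
have := A_ge0 that; rewrite le_eqVlt => /predU1P[A0|A_gt0].
  (* the weight of the estimate, hence the right-hand side, is infinite *)
  suff -> : S = +oo by rewrite gt0_muley ?lte_fin// addey// addye// leey.
  apply/eqP; rewrite -leye_eq (le_trans _ S_ge)// /tilted_likelihood /tilt_weight -A0.
  rewrite powR0 ?gt_eqF// inve0 gt0_muley ?lte_fin ?expR_gt0// gt0_mulye//.
  rewrite lte_fin prodr_gt0// => i _; rewrite /sqrt_ratio that_gt0 andbT.
  by case/andP: (pos i) => -> _; exact: expR_gt0.
set u := (- (2^-1 * L that) - kappa * ln (A that) +
  \sum_(i < n) (ln (p_ that (x i)) - ln (p (x i))) / 2)%R.
have termE : tilted_likelihood that x = (expR u)%:E.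
  rewrite /tilted_likelihood /tilt_weight inver gt_eqF ?powR_gt0//= -!EFinM; congr EFin.
  rewrite /u 2!expRD expR_sum /powR gt_eqF// expRN; congr (_ * _)%R.
  by apply: eq_bigr => i _; rewrite /sqrt_ratio that_gt0; case/andP: (pos i) => ->.
have -> : (A that)%:E^-1 = (A that)^-1%:E by rewrite inver gt_eqF.
rewrite lne_EFin ?invr_gt0// lnV ?posrE//.
apply: (@le_trans _ _ ((2 * (ln s - 1) + L theta)%:E + (2 / s)%:E * (expR u)%:E +
    (\sum_(i < n) (ln (p (x i)) - ln (p_ theta (x i))))%:E)).
  have := expR_ge1Dx (u - ln s); rewrite expRD expRN lnK ?posrE// => us.
  rewrite -!EFinM -!EFinD lee_fin.
  move: us; rewrite {1}/u -mulr_suml !sumrB; move: mle.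
  by lra.
rewrite leeD2r// leeD2l//; apply: lee_wpmul2l; first by rewrite lee_fin ltW.
by rewrite -termE.
Qed.

Let D theta := relative_entropy mu p (p_ theta).

(** The expectation of [mle_pointwise]: as the mean of [W] is at most [s], the terms
[- 2] and [(2 / s) W] contribute at most 0. *)
Lemma expectation_bound (s : R) (theta : Theta) : (0 < s)%R ->
  \esum_(t in [set: Theta])
    (expR (- (2^-1 * L t)) * A t `^ (alpha * n%:R))%:E <= s%:E ->
  D theta < +oo ->
  kappa%:E * \int[Pr]_w bhattacharyya_div mu p (p_ (thetahat (fun i => X i w)))
  <= (2 * ln s + L theta)%:E + n%:R%:E * D theta.
Proof.
move=> s_gt0 S_le D_fin.
pose r := (2 * (ln s - 1) + L theta)%R.
pose h w := \sum_(i < n) log_ratio p (p_ theta) (X i w).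
pose f w := bhattacharyya_div mu p (p_ (thetahat (fun i => X i w))).
pose H w := (r%:E + (2 / s)%:E * W w) + h w.
have f0 w : 0 <= f w by exact: (bhattacharyya_div_ge0 hp (hp_ _)).
have fH w : kappa%:E * f w <= H w by exact: mle_pointwise.
have H0 w : 0 <= H w.
  by apply: le_trans (fH w); rewrite mule_ge0 ?lee_fin// ltW.
have W0 w : 0 <= W w by apply: esum_ge0 => t _; exact: tilted_likelihood_ge0.
have IW : \int[Pr]_w W w <= s%:E by exact: le_trans integral_sum_tilted_likelihood_le _.
have s2 : (0 < 2 / s)%R by rewrite divr_gt0.
have intW : Pr.-integrable setT W.
  apply/integrableP; split => //.
  under eq_integral do rewrite gee0_abs//.
  exact: le_lt_trans IW (ltry s).
have intl i : Pr.-integrable setT (fun w => log_ratio p (p_ theta) (X i w)).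
  by apply: (integrable_iid hX); exact: (integrable_log_ratio hp (hp_ theta)).
have inth : Pr.-integrable setT h by exact: integrable_sum.
have intr : Pr.-integrable setT (fun=> r%:E) by exact: finite_measure_integrable_cst.
have int2W : Pr.-integrable setT (fun w => (2 / s)%:E * W w) by exact: integrableZl.
have intrW : Pr.-integrable setT (fun w => r%:E + (2 / s)%:E * W w).
  exact: integrableD.
have intH : Pr.-integrable setT H by exact: integrableD.
have -> : (2 * ln s + L theta)%:E + n%:R%:E * D theta =
    r%:E + (2 / s)%:E * s%:E + n%:R%:E * D theta.
  by rewrite -EFinM -EFinD; congr (_%:E + _); rewrite /r; field; rewrite gt_eqF.
have Hle : \int[Pr]_w H w <= r%:E + (2 / s)%:E * s%:E + n%:R%:E * D theta.
  rewrite integralD// integralD// integral_cst//.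
  rewrite [X in _ * X + _ + _](probability_setT Pr) mule1.
  rewrite integralZl// integral_sum//.
  rewrite (eq_bigr (fun=> D theta)); last first.
    move=> i _; rewrite (integral_iid hX); last first.
      exact: (measurable_log_ratio hp (hp_ theta)).
    by rewrite -(relative_entropyE hp (hp_ theta)).
  rewrite mule_natl big_const_ord -Monoid.iteropE leeD2r// leeD2l//.
  by apply: lee_wpmul2l => //; rewrite lee_fin ltW.
apply: le_trans Hle.
have -> : \int[Pr]_w H w = kappa%:E * \int[Pr]_w ((kappa^-1)%:E * H w).
  rewrite ge0_integralZl//; last 2 first.
  - exact: measurable_int intH.
  - by rewrite lee_fin invr_ge0 ltW.
  by rewrite muleA -EFinM divff ?mul1e// gt_eqF.
apply: lee_wpmul2l; first by rewrite lee_fin ltW.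
apply: le_ge0_integralT => // w.
by rewrite lee_pdivlMl ?kappa_gt0 ?fH.
Qed.

End penalized_mle.

(* The sum in the bracket is the dual addition, for which
   [+oo + -oo = -oo + +oo = +oo]; it agrees with the usual one whenever the sum
   is not of the form oo - oo. *)
Theorem mainTheorem5 (R : realType)
  (d : measure_display) (T : measurableType d)
  (mu : {measure set T -> \bar R})
  (P : probability T R) (p : T -> R) (hp : is_density mu P p)
  (Theta : countType) (P_ : Theta -> probability T R) (p_ : Theta -> T -> R)
  (hp_ : forall theta, is_density mu (P_ theta) (p_ theta))
  (L : Theta -> R) (n : nat) (n_gt0 : (0 < n)%N)
  (d' : measure_display) (Omega : measurableType d') (Pr : probability Omega R)
  (X : 'I_n -> {RV Pr >-> T}) (hX : iid P X)
  (thetahat : ('I_n -> T) -> Theta)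
  (hthetahat : is_penalized_mle p_ L thetahat)
  (alpha : R) (alpha_ge0 : (0 <= alpha)%R) (alpha_lt1 : (alpha < 1)%R) :
  \int[Pr]_w bhattacharyya_div mu p (p_ (thetahat (fun i => X i w))) <=
  ((1 - alpha)^-1)%R%:E *
  (resolvability mu n p p_ L +
   (2%:E * lne (\esum_(theta in [set: Theta])
       (expR (- (2^-1 * L theta)) *
        hellinger_affinity mu p (p_ theta) `^ (alpha * n%:R))%R%:E)
    / n%:R%:E))%dE.
Proof.
set I := \int[Pr]_w _; set S := esum _ _.
rewrite [resolvability _ _ _ _ _]/resolvability.
set A := ereal_inf _.
have I0 : 0 <= I.
  by apply: integral_ge0 => w _; exact: bhattacharyya_div_ge0 hp (hp_ _).
have S0 : 0 <= S.
  by apply: esum_ge0 => t _; rewrite lee_fin mulr_ge0 ?expR_ge0 ?powR_ge0.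
have n0 : (0 < n%:R :> R)%R by rewrite ltr0n.
have a0 : (0 < 1 - alpha)%R by rewrite subr_gt0.
have bound (s : R) theta : (0 < s)%R -> S <= s%:E ->
    relative_entropy mu p (p_ theta) < +oo ->
    exists dv : R, relative_entropy mu p (p_ theta) = dv%:E /\
      exists2 ir : R, I = ir%:E &
        ((1 - alpha) * n%:R * ir <= 2 * ln s + L theta + n%:R * dv)%R.
  move=> s_gt0 Ss fin.
  have := expectation_bound hp hp_ L n_gt0 hX hthetahat alpha_lt1 s theta s_gt0 Ss fin.
  rewrite -/I.
  have : relative_entropy mu p (p_ theta) \is a fin_num.
    rewrite (relative_entropyE hp (hp_ theta)).
    apply: integrable_fin_num => //.
    exact: (integrable_log_ratio hp (hp_ theta)).
  case: relative_entropy => // dv _; rewrite -EFinM -EFinD.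
  case: I I0 => [ir|_|//]; last by rewrite gt0_muley ?lte_fin ?mulr_gt0.
  by rewrite -EFinM lee_fin => _ h; exists dv; split => //; exists ir.
have RHSoo : I <= ((1 - alpha)^-1)%:E * +oo.
  by rewrite gt0_muley ?lte_fin ?invr_gt0// leey.
case: S S0 bound => [r|_ _|//]; last first.
  rewrite /= gt0_muley ?lte_fin// gt0_mulye ?inver ?gt_eqF ?lte_fin ?invr_gt0//.
  by rewrite DualAddTheoryNumDomain.daddey.
rewrite lee_fin le_eqVlt => /predU1P[<-|r0] bound.
  (* S = 0: every relative entropy is infinite *)
  rewrite [A](_ : _ = +oo) ?DualAddTheoryNumDomain.daddye//.
  apply/eqP; rewrite -leye_eq; apply/ereal_infP => _ [theta _ <-].
  have [->|] := eqVneq (relative_entropy mu p (p_ theta)) +oo; first by [].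
  rewrite -ltey => fin; exfalso.
  have s_ge (s : R) : (0 < s)%R -> 0 <= s%:E by rewrite lee_fin => /ltW.
  have [dv [Ddv _]] := bound 1%R theta ltr01 (s_ge _ ltr01) fin.
  (* s is chosen so that the bound on the nonnegative expectation is -2 *)
  pose s : R := expR (- ((L theta + n%:R * dv) / 2) - 1).
  have [dv' [Dv [ir Iir]]] := bound s theta (expR_gt0 _) (s_ge _ (expR_gt0 _)) fin.
  move: Dv; rewrite Ddv => -[<-]; rewrite expRK => h.
  have ir0 : (0 <= ir)%R by rewrite -lee_fin -Iir.
  have : (0 <= (1 - alpha) * n%:R * ir)%R by rewrite !mulr_ge0// ltW.
  by move: h; lra.
rewrite lne_EFin// inver gt_eqF// -!EFinM.
set c := (2 * ln r / n%:R)%R.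
have key : (1 - alpha)%:E * I - c%:E <= A.
  apply/ereal_infP => _ [theta _ <-].
  have [->|] := eqVneq (relative_entropy mu p (p_ theta)) +oo.
    by rewrite addye// leey.
  rewrite -ltey => fin.
  have [dv [-> [ir -> h]]] := bound r theta r0 (lexx _) fin.
  rewrite -EFinM -EFinB -EFinD lee_fin.
  rewrite -(ler_pM2r n0) /c mulrBl [leRHS]mulrDl !divfK ?gt_eqF//.
  by move: h; lra.
case: A key => [a key|_|]; last 2 first.
- by rewrite DualAddTheoryNumDomain.daddye.
- case: I I0 {RHSoo bound} => [ir _|_|//].
    by rewrite -EFinM -EFinB leeNy_eq.
  by rewrite gt0_muley ?lte_fin.
have {bound RHSoo}[ir Iir] : exists ir, I = ir%:E.
  case: I I0 key {bound RHSoo} => [ir _ _|_|//]; first by exists ir.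
  by rewrite gt0_muley ?lte_fin.
move: key; rewrite Iir -EFinM -EFinB lee_fin => key.
rewrite -[(_ + _)%dE]/((a + c)%R%:E) -EFinM lee_fin mulrC ler_pdivlMr//.
by move: key; lra.
Qed.
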